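(* Let $\{P_n(\eta)\}$ be a family of classical orthogonal polynomials with sinusoidal coordinate $\eta(x)$, governing operator $\widetilde{\mathcal H}$ and eigenvalues $\mathcal{E}(n)$, so that $\widetilde{\mathcal H}P_n(\eta(x))=\mathcal{E}(n)P_n(\eta(x))$. Fix a positive integer $\mathcal{N}$ (with $\mathcal{N}<N$ if the family is defined on a finite lattice $\{0,1,\ldots,N\}$), let $\eta(x_1),\ldots,\eta(x_{\mathcal N})$ be the zeros of $P_{\mathcal N}$, and define the $\mathcal{N}\times\mathcal{N}$ matrix $\mathcal{M}$ by $$\mathcal{M}_{n\,m}=-\frac{\dot{\eta}(x_m)\left.\left(\bigl(\widetilde{\mathcal H}-\mathcal{E}(\mathcal{N})\bigr)\prod_{j\neq m}\bigl(\eta(x)-\eta(x_j)\bigr)\right)\right|_{x=x_n}}{\dot{\eta}(x_n)\prod_{j\neq n}\bigl(\eta(x_n)-\eta(x_j)\bigr)},\qquad n,m=1,\ldots,\mathcal{N},$$ where $j$ runs over $\{1,\ldots,\mathcal{N}\}$ in the products. For $m\in\{0,1,\ldots,\mathcal{N}-1\}$ let $\mathrm{v}^{(m)}=(\mathrm{v}^{(m)}_1,\ldots,\mathrm{v}^{(m)}_{\mathcal N})$ be an eigenvector of $\mathcal{M}$ with eigenvalue $\mathcal{E}(\mathcal{N})-\mathcal{E}(m)$, that is, a nonzero vector with $$\sum_{\ell=1}^{\mathcal N}\mathcal{M}_{n\,\ell}\,\mathrm{v}^{(m)}_{\ell}=(\mathcal{E}(\mathcal{N})-\mathcal{E}(m))\,\mathrm{v}^{(m)}_n,\qquad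 n=1,\ldots,\mathcal{N}.$$ Then the eigenvector represents the lower degree polynomial $P_m$ in terms of the zeros of $P_{\mathcal N}$: there is a nonzero constant $\kappa_m$ such that, identically in $\eta$, $$\sum_{n=1}^{\mathcal N}\dot{\eta}(x_n)\,\mathrm{v}^{(m)}_n\prod_{j\neq n}\bigl(\eta-\eta(x_j)\bigr)=\kappa_m\,P_m(\eta),\qquad m=0,1,\ldots,\mathcal{N}-1.$$
   Context: Setting. A family of classical orthogonal polynomials consists of the following data. $\eta(x)$ is a function of one variable $x$ (the sinusoidal coordinate; in the examples $x$, $x^2$, $x(x+d)$, $\cos x$, $\cos 2x$, $q^{-x}-1$, $1-q^x$, or $(q^{-x}-1)(1-Aq^x)$), with $\dot\eta(x)=d\eta(x)/dx$. For each $n$, $P_n(\eta)$ is a polynomial of degree exactly $n$ in $\eta$, where $n=0,1,2,\ldots$, or $n=0,1,\ldots,N$ for families on a finite lattice. The $P_n(\eta(x))$ are orthogonal with respect to a positive weight $\phi_0(x)^2$ on an interval of $x$ or, in the discrete case, on the lattice $\{0,1,\ldots,N\}$ or $\{0,1,2,\ldots\}$; they satisfy a three-term recurrence relation. There is a second order linear differential or difference operator $\widetilde{\mathcal H}$ acting on functions of $x$ and numbers $\mathcal{E}(n)$ with $$\widetilde{\mathcal H}P_n(\eta(x))=\mathcal{E}(n)P_n(\eta(x)),$$ understood as an identity between analytic functions of $x$. The operator $\widetilde{\mathcal H}=\phi_0(x)^{-1}\circ\mathcal{H}\circ\phi_0(x)$ is the similarity transform of a one-dimensional exactly solvable Hamiltonian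 $\mathcal{H}$ with eigenfunctions $\phi_0(x)P_n(\eta(x))$ and eigenvalues $\mathcal{E}(n)$, which are pairwise distinct. It is of one of three types: (i) a second order differential operator in $x$; (ii) $\widetilde{\mathcal H}=V(x)(e^{-i\gamma\partial_x}-1)+V^*(x)(e^{i\gamma\partial_x}-1)$, with $\gamma$ real and nonzero, $e^{\pm i\gamma\partial_x}\psi(x)=\psi(x\pm i\gamma)$, $V$ an analytic function, and $V^*$ obtained from $V$ by complex conjugating its power series coefficients; (iii) $\widetilde{\mathcal H}=B(x)(1-e^{\partial})+D(x)(1-e^{-\partial})$, with $e^{\pm\partial}\psi(x)=\psi(x\pm1)$, $B,D\ge0$ on the lattice, $D(0)=0$, and $B(N)=0$ in the finite lattice case. Consequently $\widetilde{\mathcal H}$ maps a polynomial in $\eta(x)$ of degree at most $n$ to a polynomial in $\eta(x)$ of degree at most $n$; expressions $(\widetilde{\mathcal H}Q(\eta(x)))|_{x=x_n}$ are evaluations of this resulting polynomial. The zeros of $P_{\mathcal N}$ are real and simple, being those of an orthogonal polynomial; they are written $\eta(x_1),\ldots,\eta(x_{\mathcal N})$, with points $x_n$ such that $\dot\eta(x_n)\neq0$. Empty products equal $1$. *)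

(* Defs.v *)
From mathcomp Require Import all_boot all_order all_algebra.
From mathcomp Require Import complex.
From mathcomp Require Import all_classical all_reals all_analysis.

Set Implicit Arguments.
Unset Strict Implicit.
Unset Printing Implicit Defensive.

Import Order.TTheory GRing.Theory Num.Theory.
Import numFieldNormedType.Exports.

Local Open Scope classical_set_scope.
Local Open Scope ring_scope.
Local Open Scope complex_scope.

(* The coordinate x is real, but the operators involve shifts x -> x - i gamma
   and identities between analytic functions of x, so functions of x are
   functions on R[i].  The type R[i]^o is R[i] with the topology given by its
   norm. *)

Section Analytic.
Variable R : realType.

Definition cderiv (f : R[i] -> R[i]) : R[i] -> R[i] :=
  derive1 (f : R[i] -> R[i]^o).

Definition power_series_at (f : R[i] -> R[i]) (z0 : R[i]) (a : nat -> R[i]) :=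
  \forall z \near (z0 : R[i]^o),
    ([series a k * (z - z0) ^+ k]_k : nat -> R[i]^o) @ \oo --> (f z : R[i]^o).

Definition analytic_on (A : set R[i]) (f : R[i] -> R[i]) :=
  forall z0, A z0 -> exists a, power_series_at f z0 a.

Definition domain (A : set R[i]) :=
  open (A : set R[i]^o) /\ connected (A : set R[i]^o).

(* The coefficients are conjugated in the expansions around real points;
   0 itself may be a singularity. *)
Definition conj_coefficients (A : set R[i]) (V Vstar : R[i] -> R[i]) :=
  forall (x0 : R) a, A x0%:C ->
    power_series_at V x0%:C a -> power_series_at Vstar x0%:C (fun k => (a k)^*).

End Analytic.

(* Where the weight lives; Lattice (Some N) is {0, ..., N} and Lattice None is
   {0, 1, 2, ...}. *)
Variant support (R : realType) : Type :=
  | Interval of \bar R & \bar R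
  | Lattice of option nat.

Arguments Lattice {R}.

Section Support.
Variable R : realType.
Implicit Type S : support R.

Definition points S : set R :=
  match S with
  | Interval a b => [set x | (a < x%:E < b)%E]
  | Lattice (Some N) => [set x | exists2 k : nat, (k <= N)%N & x = k%:R]
  | Lattice None => [set x | exists k : nat, x = k%:R]
  end.

Definition degree_ok S (n : nat) : bool :=
  if S is Lattice (Some N) then (n <= N)%N else true.

Definition degree_below_top S (n : nat) : bool :=
  if S is Lattice (Some N) then (n < N)%N else true.

Definition has_total S (f : R -> R) (s : R) : Prop :=
  match S with
  | Interval _ _ =>
      (@lebesgue_measure R).-integrable (points S) (EFin \o f) /\
      Rintegral (@lebesgue_measure R) (points S) f = s
  | Lattice (Some N) => \sum_(k < N.+1) f k%:R = s
  | Lattice None =>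
      cvgn [normed series (fun k : nat => f k%:R)] /\
      series (fun k : nat => f k%:R) @ \oo --> s
  end.

End Support.

Variant operator (R : realType) : Type :=
  | Differential of (R[i] -> R[i]) & (R[i] -> R[i]) & (R[i] -> R[i])
  | ImaginaryShift of R & (R[i] -> R[i]) & (R[i] -> R[i])
  | RealShift of (R[i] -> R[i]) & (R[i] -> R[i]).

Section Operator.
Variable R : realType.

Definition apply_op (T : operator R) (psi : R[i] -> R[i]) (z : R[i]) : R[i] :=
  match T with
  | Differential a2 a1 a0 =>
      a2 z * cderiv (cderiv psi) z + a1 z * cderiv psi z + a0 z * psi z
  | ImaginaryShift g V Vstar =>
      V z * (psi (z - 'i * g%:C) - psi z)
      + Vstar z * (psi (z + 'i * g%:C) - psi z)
  | RealShift B D =>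
      B z * (psi z - psi (z + 1)) + D z * (psi z - psi (z - 1))
  end.

(* The coefficients of T are analytic on A, and T maps functions on U to
   functions on A. *)
Definition admissible (S : support R) (U A : set R[i]) (T : operator R) : Prop :=
  match T, S with
  | Differential a2 a1 a0, Interval _ _ =>
      [/\ analytic_on A a2, analytic_on A a1, analytic_on A a0
        & exists2 z, A z & a2 z != 0]
  | ImaginaryShift g V Vstar, Interval _ _ =>
      [/\ g != 0, analytic_on A V, analytic_on A Vstar, conj_coefficients A V Vstar
        & forall z, A z -> U (z - 'i * g%:C) /\ U (z + 'i * g%:C)]
  | RealShift B D, Lattice oN =>
      [/\ analytic_on A B, analytic_on A D,
          forall z, A z -> U (z + 1) /\ U (z - 1),
          forall x, points S x -> 0 <= B x%:C /\ 0 <= D x%:C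
        & D 0 = 0 /\ (if oN is Some N then B N%:R = 0 else True)]
  | _, _ => False
  end.

End Operator.

Record op_family (R : realType) : Type := OpFamily {
  supp : support R;
  eta_dom : set R[i];
  eta : R[i] -> R[i];
  pol : nat -> {poly R};   (* only pol n with degree_ok supp n is meaningful *)
  phi0 : R -> R;
  op_dom : set R[i];       (* excludes the singularities of the coefficients *)
  op : operator R;
  energy : nat -> R;
  eta_dom_domain : domain eta_dom;
  eta_analytic : analytic_on eta_dom eta;
  eta_real : forall x : R, eta_dom x%:C -> complex.Im (eta x%:C) = 0;
  op_dom_domain : domain op_dom;
  op_dom_sub : op_dom `<=` eta_dom;
  supp_op_dom : forall x : R, points supp x -> op_dom x%:C;
  op_admissible : admissible supp eta_dom op_dom op;
  pol_size : forall n, degree_ok supp n -> size (pol n) = n.+1;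
  weight_gt0 : forall x, points supp x -> 0 < phi0 x ^+ 2;
  pol_orthogonal : exists2 h : nat -> R,
    forall n, degree_ok supp n -> 0 < h n &
    forall n m, degree_ok supp n -> degree_ok supp m ->
      has_total supp
        (fun x => phi0 x ^+ 2 * (pol n).[complex.Re (eta x%:C)]
                  * (pol m).[complex.Re (eta x%:C)])
        (if n == m then h n else 0);
  pol_recurrence : forall n, degree_ok supp n.+1 -> exists a b c : R,
    'X * pol n = a *: pol n.+1 + b *: pol n + (if n is k.+1 then c *: pol k else 0);
  pol_eigen : forall n, degree_ok supp n -> forall z, op_dom z ->
    apply_op op (fun w => (map_poly (real_complex R) (pol n)).[eta w]) z
    = (energy n)%:C * (map_poly (real_complex R) (pol n)).[eta z];
  energy_inj : forall n m, degree_ok supp n -> degree_ok supp m ->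
    energy n = energy m -> n = m
}.

Section Matrix.
Variables (R : realType) (F : op_family R).

Definition cpol (n : nat) : {poly R[i]} := map_poly (real_complex R) (pol F n).

Definition etadot (x : R) : R[i] := cderiv (eta F) x%:C.

Definition is_op_poly (Q r : {poly R[i]}) : Prop :=
  (size r <= size Q)%N /\
  forall z, op_dom F z ->
    apply_op (op F) (fun w => Q.[eta F w]) z = r.[eta F z].

(* The polynomial r, of degree at most that of Q, such that applying the
   operator to Q(eta(x)) gives r(eta(x)).  The evaluations at x = x_n are those
   of r: x_n may be a (removable) singularity of the coefficients. *)
Definition op_poly (Q : {poly R[i]}) : {poly R[i]} :=
  xget 0 [set r | is_op_poly Q r].

Section Zeros.
Variables (N : nat) (x : 'I_N -> R).

Definition node_poly (m : 'I_N) : {poly R[i]} :=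
  \prod_(j < N | j != m) ('X - (eta F (x j)%:C)%:P).

Definition M_matrix : 'M[R[i]]_N :=
  \matrix_(n, m)
    - ((etadot (x m) *
        (op_poly (node_poly m) - (energy F N)%:C *: node_poly m).[eta F (x n)%:C])
       / (etadot (x n) *
          \prod_(j < N | j != n) (eta F (x n)%:C - eta F (x j)%:C))).

End Zeros.
End Matrix.

(* Main.v *)
(* Apply the operator to polynomials of size at most N: on the span of
   P_0, ..., P_(N-1) it is diagonal with eigenvalues E(0), ..., E(N-1).  Let Q be
   the polynomial sum_n etadot(x_n) v_n prod_(j != n) (eta - eta(x_j)), whose
   value at the n-th node is etadot(x_n) v_n prod_(j != n) (eta(x_n) - eta(x_j)).
   The eigenvector equation says that (H - E(N)) Q and (E(m) - E(N)) Q agree at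
   the N nodes; both have size at most N, so H Q = E(m) Q, and Q is a multiple
   of P_m because the eigenvalues are distinct.

   Two points need analysis.  The operator is linear on polynomials in eta: for
   differential operators this uses that a power series is twice complex
   differentiable.  The polynomial representing H Q is unique: a polynomial in
   eta vanishing on the support has zero coordinates in the P_k by
   orthogonality. *)

Require Import Defs.
From mathcomp Require Import all_boot all_order all_algebra.
From mathcomp Require Import complex.
From mathcomp Require Import all_classical all_reals all_analysis.
From mathcomp Require Import measurable_realfun ring lra.

Set Implicit Arguments.
Unset Strict Implicit.
Unset Printing Implicit Defensive.

Import Order.TTheory GRing.Theory Num.Theory.
Import numFieldNormedType.Exports.

Local Open Scope ring_scope.
Local Open Scope complex_scope.

(** * Power series *)

Lemma limit_norm_le (K : numFieldType) (V : normedModType K) (u : nat -> V)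
    (l : V) (B : K) :
  (u @ \oo --> l)%classic -> (forall n, `|u n| <= B) -> `|l| <= B.
Proof.
move=> ul uB.
have B0 : 0 <= B := le_trans (normr_ge0 _) (uB 0%N).
rewrite real_leNgt ?ger0_real//; apply/negP => Bl.
have e0 : 0 < `|l| - B by rewrite subr_gt0.
have [n _ /(_ n (leqnn n)) /=] := cvgr_dist_lt _ _ ul _ e0.
rewrite ltrBrDl => /(le_lt_trans _) lt_l.
have /lt_l : `|l| <= B + `|l - u n|.
  by rewrite -{1}(subrK (u n) l) addrC (le_trans (ler_normD _ _))// lerD2r.
by rewrite ltxx.
Qed.

(** * Complex series dominated by a geometric series of ratio 1/2 *)

Section Geometric.
Variable R : realType.
Local Notation C := R[i].

Lemma normc_le_ReIm (z : C) : `|z| <= (`|complex.Re z| + `|complex.Im z|)%:C.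
Proof.
rewrite {1}(complexE z) (le_trans (ler_normD _ _))// rmorphD /= normrM.
have -> : `|'i : C| = 1 by rewrite normc_def /= expr0n expr1n add0r sqrtr1.
by rewrite mul1r !normc_def /= !expr0n /= !addr0 !sqrtr_sqr.
Qed.

Lemma cvg_ReIm (u : nat -> C^o) (a b : R) :
  ((fun n => complex.Re (u n)) @ \oo --> a)%classic ->
  ((fun n => complex.Im (u n)) @ \oo --> b)%classic ->
  (u @ \oo --> (a +i* b : C^o))%classic.
Proof.
move=> ua ub; apply/cvgrPdist_lt => e e0.
have eE : e = (complex.Re e)%:C by rewrite RRe_real ?gtr0_real.
have e0' : 0 < complex.Re e by rewrite -ltcR -eE.
near=> n; apply: le_lt_trans (normc_le_ReIm _) _; rewrite eE ltcR.
rewrite (splitr (complex.Re e)) ltrD//.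
  have -> : complex.Re (a +i* b - u n) = a - complex.Re (u n) by case: (u n).
  by near: n; apply: cvgr_dist_lt ua _ _; rewrite divr_gt0.
have -> : complex.Im (a +i* b - u n) = b - complex.Im (u n) by case: (u n).
by near: n; apply: cvgr_dist_lt ub _ _; rewrite divr_gt0.
Unshelve. all: by end_near. Qed.

Lemma normc_ge_Im (z : C) : `|complex.Im z|%:C <= `|z|.
Proof. by rewrite normc_def lecR -sqrtr_sqr ler_wsqrtr// lerDr sqr_ge0. Qed.

Lemma cvg_series_half (u : nat -> R) (M : R) :
  (forall k, `|u k| <= M * 2^-1 ^+ k) -> cvgn (series u).
Proof.
move=> uM; apply: normed_cvg; apply: (@series_le_cvg _ _ (geometric M 2^-1)).
- by move=> n; exact: normr_ge0.
- by move=> n; exact: le_trans (normr_ge0 _) (uM n).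
- exact: uM.
- by apply: is_cvg_geometric_series; rewrite ger0_norm ?invf_lt1 ?ltr1n.
Qed.

(** The real and imaginary parts are dominated by the same geometric series, so convergence reduces
    to comparison of real series. *)
Lemma cvg_cseries_half (u : nat -> C^o) (M : C) :
  (forall k, `|u k| <= M * 2^-1 ^+ k) ->
  exists l, (series u @ \oo --> (l : C^o))%classic.
Proof.
move=> uM.
have M0 : 0 <= M by rewrite -[M]mulr1 -(expr0 2^-1) (le_trans (normr_ge0 _) (uM 0%N)).
have ME k : M * 2^-1 ^+ k = (complex.Re M * 2^-1 ^+ k)%:C.
  by rewrite rmorphM rmorphXn/= fmorphV/= rmorph_nat RRe_real ?ger0_real.
have cRe : cvgn (series (fun k => complex.Re (u k))).
  apply: (@cvg_series_half _ (complex.Re M)) => k.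
  by rewrite -lecR -ME (le_trans (normc_ge_Re _)).
have cIm : cvgn (series (fun k => complex.Im (u k))).
  apply: (@cvg_series_half _ (complex.Re M)) => k.
  by rewrite -lecR -ME (le_trans (normc_ge_Im _)).
have [a ha] := (cvg_ex _).1 cRe; have [b hb] := (cvg_ex _).1 cIm.
exists (a +i* b); apply: cvg_ReIm.
- rewrite (_ : (fun n => _) = series (fun k => complex.Re (u k)))//.
  by apply/funext => n; rewrite /series /= (raddf_sum (@complex.Re R : Rcomplex R -> R)).
- rewrite (_ : (fun n => _) = series (fun k => complex.Im (u k)))//.
  by apply/funext => n; rewrite /series /= (raddf_sum (@complex.Im R : Rcomplex R -> R)).
Qed.

Lemma series_half_le (u : nat -> C^o) (M : C) n :
  (forall k, `|u k| <= M * 2^-1 ^+ k) -> `|series u n| <= 2 * M.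
Proof.
move=> uM.
have M0 : 0 <= M by rewrite -[M]mulr1 -(expr0 2^-1) (le_trans (normr_ge0 _) (uM 0%N)).
(* The bound by the exact geometric partial sum is the one that survives induction. *)
suff : `|series u n| <= 2 * M - 2 * M * 2^-1 ^+ n.
  move=> /le_trans; apply; rewrite lerBlDr lerDl !mulr_ge0 ?exprn_ge0 ?invr_ge0//.
elim: n => [|n IH]; first by rewrite /series /= big_geq// normr0 expr0 mulr1 subrr.
rewrite /series /= big_nat_recr//=.
apply: le_trans (ler_normD _ _) _; apply: le_trans (lerD IH (uM n)) _.
rewrite exprS le_eqVlt; apply/orP; left; apply/eqP; by field.
Qed.

End Geometric.

(* The factor s ^+ 2 avoids the exponent n - 2, which would be truncated. *)
Lemma expr_taylor1_le (K : numDomainType) (w h s : K) n :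
  `|w| <= s -> `|w + h| <= s ->
  s ^+ 2 * `|(w + h) ^+ n - w ^+ n - h * (n%:R * w ^+ n.-1)|
    <= `|h| ^+ 2 * (4 * s) ^+ n.
Proof.
move=> ws whs; have s0 : 0 <= s := le_trans (normr_ge0 _) ws.
have h0 : 0 <= `|h| ^+ 2 by rewrite exprn_ge0.
elim: n => [|n IH].
  by rewrite !expr0 mul0r mulr0 subrr subr0 normr0 mulr0 mulr1.
have -> : (w + h) ^+ n.+1 - w ^+ n.+1 - h * (n.+1%:R * w ^+ n.+1.-1)
    = (w + h) * ((w + h) ^+ n - w ^+ n - h * (n%:R * w ^+ n.-1))
      + h ^+ 2 * (n%:R * w ^+ n.-1).
  case: n {IH} => [|n] /=; first by rewrite !expr0 !expr1 !mul0r; ring.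
  by rewrite !exprS -!natr1; ring.
(* Since 4^(n+1) = 4^n + 3 * 4^n, the first term of the recursion uses up 4^n and leaves 3 * 4^n to
   absorb the factor n of the second. *)
have n4 : n%:R <= 3 * 4 ^+ n :> K.
  rewrite -[4]/(4%:R) -natrX -natrM ler_nat.
  by apply: leq_trans (ltnW (ltn_expl n (isT : (1 < 4)%N))) _; rewrite leq_pmull.
apply: le_trans (ler_wpM2l (exprn_ge0 _ s0) (ler_normD _ _)) _.
rewrite mulrDr !(normrX, normrM) normr_nat.
have -> : `|h| ^+ 2 * (4 * s) ^+ n.+1
    = s * (`|h| ^+ 2 * (4 * s) ^+ n) + s * s ^+ n * `|h| ^+ 2 * (3 * 4 ^+ n).
  by rewrite !exprMn !exprS; ring.
apply: lerD.
  by rewrite mulrCA; apply: ler_pM => //; rewrite mulr_ge0 ?exprn_ge0.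
case: n {IH} n4 => [|n] n4.
  by rewrite mul0r !mulr0 !mulr_ge0 ?exprn_ge0.
have -> : s ^+ 2 * (`|h| ^+ 2 * (n.+1%:R * `|w| ^+ n.+1.-1))
    = s * (s * `|w| ^+ n) * `|h| ^+ 2 * n.+1%:R by rewrite /=; ring.
apply: ler_pM => //; first by rewrite !mulr_ge0 ?exprn_ge0.
apply: ler_wpM2r => //; apply: ler_wpM2l => //; rewrite exprS.
by apply: ler_wpM2l => //; rewrite lerXn2r ?nnegrE.
Qed.

(** After division by h, the quadratic error leaves the difference quotient within B |h| of [l].
    This turns a bound on Taylor remainders into a derivative. *)
Lemma is_derive_quadratic (K : numFieldType) (f : K -> K^o) (z l d B : K) :
  0 < d ->
  (forall h, `|h| < d -> `|f (h + z) - f z - h * l| <= B * `|h| ^+ 2) ->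
  is_derive (z : K^o) 1 (f : K^o -> K^o) l.
Proof.
move=> d0 fB.
have B0 : 0 <= B.
  have d2 : `|d / 2| < d.
    by rewrite gtr0_norm ?divr_gt0// ltr_pdivrMr// mulr_natr mulr2n ltrDl.
  have := le_trans (normr_ge0 _) (fB _ d2).
  by rewrite pmulr_lge0// exprn_gt0// normr_gt0 gt_eqF// divr_gt0.
pose g (h : K^o) : K^o := h^-1 *: (((f : K^o -> K^o) \o shift z) (h *: (1 : K^o)) - f z).
suff gl : (g @ 0^' --> (l : K^o))%classic.
  apply: DeriveDef; first by apply: cvgP gl.
  apply: (cvg_lim _ gl). exact: norm_hausdorff.
apply/cvgrPdist_le => e e0.
(* This radius lies below both d and e / (B + 1) and so serves as their minimum; B + 1 stays
   positive when B = 0. *)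
have k0 : 0 < (d^-1 + (B + 1) / e)^-1.
  by rewrite invr_gt0 ltr_pwDl ?invr_gt0// divr_ge0 ?addr_ge0// ltW.
apply/nbhs_ballP; exists (d^-1 + (B + 1) / e)^-1 => //= h.
rewrite -ball_normE /= sub0r normrN => hk hn0.
have hn : h != 0 := hn0.
have hd : `|h| < d.
  apply: lt_le_trans hk _; rewrite -[leRHS]invrK lef_pV2 ?posrE ?invr_gt0//.
    by rewrite lerDl divr_ge0 ?addr_ge0// ltW.
  by rewrite -invr_gt0.
have he : (B + 1) * `|h| <= e.
  have B1 : 0 < B + 1 by rewrite ltr_wpDl.
  rewrite -ler_pdivlMl// mulrC; apply: ltW; apply: lt_le_trans hk _.
  rewrite -[leRHS]invrK lef_pV2 ?posrE ?invr_gt0 ?divr_gt0//; last by rewrite -invr_gt0.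
  by rewrite invfM invrK mulrC lerDr invr_ge0 ltW.
rewrite /g /= [h *: _]mulr1 -[l](mulKf hn) -[h^-1 *: _]/(h^-1 * _) -mulrBr normrM normfV.
rewrite ler_pdivrMl ?normr_gt0// distrC.
apply: le_trans (fB _ hd) _; rewrite expr2 mulrA mulrC ler_wpM2l//.
by apply: le_trans he; rewrite ler_wpM2r// lerDl.
Qed.

Lemma near_normP (K : numFieldType) (z0 : K) (P : K -> Prop) :
  (\forall z \near (z0 : K^o), P z) <->
  exists2 r : K, 0 < r & forall z, `|z - z0| < r -> P z.
Proof.
split=> [/nbhs_ballP[r /= r0 rP]|[r r0 rP]].
  by exists r => // z zr; apply: rP; rewrite -ball_normE /= distrC.
apply/nbhs_ballP; exists r => //= z; rewrite -ball_normE /= distrC; exact: rP.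
Qed.

(** * Term-by-term differentiation and the chain rule for polynomials in an analytic function *)

Section PowerSeries.
Variable R : realType.
Local Notation C := R[i].

(** The series converges at z0 + r/2, so its terms there tend to 0 and are bounded; dividing by
    (r/2)^k gives geometric growth of the coefficients. *)
Lemma power_series_at_coef_le (f : C -> C) (z0 : C) (a : nat -> C) :
  power_series_at f z0 a ->
  exists M q : C, 0 < q /\ forall k, `|a k| <= M * q ^+ k.
Proof.
move=> /near_normP[r r0 fr].
have r2 : 0 < r / 2 by rewrite divr_gt0.
have : `|z0 + r / 2 - z0| < r.
  by rewrite addrAC subrr add0r gtr0_norm// ltr_pdivrMr// mulr_natr mulr2n ltrDl.
move=> /fr/cvgP/cvg_series_cvg_0.
move=> /cvgrPdist_lt/(_ 1 ltr01)[K _ Kb].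
(* From index K on the terms have norm below 1; the finite sum covers the earlier ones. *)
exists (1 + \sum_(k < K) `|a k * (r / 2) ^+ k|), (r / 2)^-1.
split=> [|k]; first by rewrite invr_gt0.
rewrite exprVn ler_pdivlMr ?exprn_gt0//.
have -> : `|a k| * (r / 2) ^+ k = `|a k * (r / 2) ^+ k|.
  by rewrite normrM normrX (gtr0_norm r2).
have [kK|Kk] := ltnP k K.
  rewrite (bigD1 (Ordinal kK))//= addrCA lerDl addr_ge0//.
  by apply: sumr_ge0 => i _; exact: normr_ge0.
apply: ler_wpDr; first by apply: sumr_ge0 => i _; exact: normr_ge0.
by have := Kb k Kk; rewrite /= sub0r normrN [z0 + _]addrC addrK => /ltW.
Qed.

(** The error f(z + h) - f(z) - h g(z) is the sum of the first-order Taylor remainders of the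
    monomials, which is O(|h|^2). The derivative is again given by a power series at the same
    centre, so the lemma can be iterated. *)
Lemma power_series_at_derive (f : C -> C) (z0 : C) (a : nat -> C) :
  power_series_at f z0 a ->
  exists2 g : C -> C,
    (\forall z \near (z0 : C^o), is_derive (z : C^o) 1 (f : C^o -> C^o) (g z)) &
    power_series_at g z0 (fun k => k.+1%:R * a k.+1).
Proof.
move=> fa; have [M [q [q0 aM]]] := power_series_at_coef_le fa.
move: fa => /near_normP[r r0 fr].
have M0 : 0 <= M by have := le_trans (normr_ge0 _) (aM 0%N); rewrite expr0 mulr1.
(* In the disc of radius s the k-th terms of the differentiated series and of the
   Taylor remainder are dominated by 2 ^- k. *)
have [s s0 [sr qs]] : exists2 s : C, 0 < s & s <= r /\ 8 * q * s <= 1.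
  have t0 : 0 < r^-1 + 8 * q by rewrite addr_gt0 ?invr_gt0// mulr_gt0.
  exists (r^-1 + 8 * q)^-1; first by rewrite invr_gt0.
  split; last by rewrite ler_pdivrMr// mul1r lerDr invr_ge0 ltW.
  by rewrite -(ler_pM2r t0) mulVf ?gt_eqF// mulrDr divff ?gt_eqF// lerDl !mulr_ge0// ltW.
have qs2 : 4 * (q * s) <= 2^-1.
  rewrite -(ler_pM2r (_ : 0 < 2))// mulVf//.
  by apply: le_trans qs; rewrite le_eqVlt; apply/orP; left; apply/eqP; ring.
have qs0 : 0 <= q * s by rewrite mulr_ge0// ltW.
pose b k := k.+1%:R * a k.+1.
(* The factor k + 1 is at most 2^k, so differentiation at most doubles the growth rate q. *)
have bM k : `|b k| <= M * q * (2 * q) ^+ k.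
  rewrite normrM normr_nat.
  apply: le_trans (ler_wpM2l (ler0n _ _) (aM _)) _.
  have -> : M * q * (2 * q) ^+ k = 2 ^+ k * (M * q ^+ k.+1).
    by rewrite exprMn exprS; ring.
  apply: ler_wpM2r; first by rewrite mulr_ge0 ?exprn_ge0// ltW.
  by rewrite -natrX ler_nat ltn_expl.
have sb z : `|z - z0| < s ->
    exists l, ((series (fun k => b k * (z - z0) ^+ k) : nat -> C^o) @ \oo --> (l : C^o))%classic.
  move=> zs; apply: (@cvg_cseries_half _ _ (M * q)) => k.
  rewrite normrM normrX.
  apply: (@le_trans _ _ (M * q * (2 * q) ^+ k * s ^+ k)).
    apply: ler_pM (bM k) _; [exact: normr_ge0|exact/exprn_ge0/normr_ge0|].
    by apply: lerXn2r; rewrite ?nnegrE ?normr_ge0 // ltW.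
  have -> : M * q * (2 * q) ^+ k * s ^+ k = M * q * (2 * (q * s)) ^+ k.
    by rewrite !exprMn; ring.
  have q2 : 2 * (q * s) <= 2^-1 by apply: le_trans qs2; rewrite ler_wpM2r// ler_nat.
  apply: ler_wpM2l; first by rewrite mulr_ge0 // ltW.
  by apply: lerXn2r => //; rewrite nnegrE ?invr_ge0// mulr_ge0.
pose g z : C := lim ((series (fun k => b k * (z - z0) ^+ k) : nat -> C^o) @ \oo)%classic.
have gP z : `|z - z0| < s ->
    ((series (fun k => b k * (z - z0) ^+ k) : nat -> C^o) @ \oo --> (g z : C^o))%classic.
  by move=> /sb[l /cvgP].
exists g; last by apply/near_normP; exists s.
apply/near_normP; exists s => // z zs.
have d0 : 0 < s - `|z - z0| by rewrite subr_gt0.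
(* The division by s^2 comes from [expr_taylor1_le], the factor 2 from summing the geometric series
   in [series_half_le]. *)
apply: (@is_derive_quadratic _ _ _ _ _ (2 * (M / s ^+ 2)) d0) => h hd.
have hzs : `|z - z0 + h| < s.
  by apply: le_lt_trans (ler_normD _ _) _; rewrite -ltrBrDl.
have fz w : `|w - z0| < s -> 
    ((series (fun k => a k * (w - z0) ^+ k) : nat -> C^o) @ \oo --> (f w : C^o))%classic.
  by move=> ws; apply: fr; exact: lt_le_trans ws sr.
have f1 := fz _ zs.
have f2 : ((series (fun k => a k * (z - z0 + h) ^+ k) : nat -> C^o)
    @ \oo --> (f (h + z) : C^o))%classic.
  have -> : z - z0 + h = h + z - z0 by ring.
  by apply: fz; rewrite -addrA addrC.
(* Shifting the index by one aligns the series of g with those of f; the added term k = 0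
   vanishes. *)
have g1 : ((series (fun k => k%:R * a k * (z - z0) ^+ k.-1) : nat -> C^o)
    @ \oo --> (g z : C^o))%classic.
  rewrite -cvg_shiftS; apply: cvg_trans (gP _ zs); apply: near_eq_cvg.
  by apply: nearW => n; rewrite /series /= big_nat_recl// !mul0r add0r.
pose u k : C^o := a k * ((z - z0 + h) ^+ k - (z - z0) ^+ k - h * (k%:R * (z - z0) ^+ k.-1)).
have uM k : `|u k| <= M / s ^+ 2 * `|h| ^+ 2 * 2^-1 ^+ k.
  rewrite normrM -(ler_pM2l (exprn_gt0 2 s0)) mulrCA.
  apply: (@le_trans _ _ (M * q ^+ k * (`|h| ^+ 2 * (4 * s) ^+ k))).
    apply: ler_pM (aM k) (expr_taylor1_le k (ltW zs) (ltW hzs)).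
      exact: normr_ge0.
    by rewrite mulr_ge0 ?exprn_ge0 ?normr_ge0 ?ltW.
  have -> : s ^+ 2 * (M / s ^+ 2 * `|h| ^+ 2 * 2^-1 ^+ k) = M * `|h| ^+ 2 * 2^-1 ^+ k.
    by field; rewrite gt_eqF.
  have -> : M * q ^+ k * (`|h| ^+ 2 * (4 * s) ^+ k) = M * `|h| ^+ 2 * (4 * (q * s)) ^+ k.
    by rewrite !exprMn; ring.
  apply: ler_wpM2l; first by rewrite mulr_ge0 ?exprn_ge0 ?normr_ge0.
  by apply: lerXn2r => //; rewrite nnegrE ?invr_ge0// mulr_ge0.
have -> : 2 * (M / s ^+ 2) * `|h| ^+ 2 = 2 * (M / s ^+ 2 * `|h| ^+ 2) by ring.
have ul : (series u @ \oo --> (f (h + z) - f z - h * g z : C^o))%classic.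
  rewrite (_ : series u = (fun n => series (fun k => a k * (z - z0 + h) ^+ k) n
      - series (fun k => a k * (z - z0) ^+ k) n
      - h * series (fun k => k%:R * a k * (z - z0) ^+ k.-1) n)).
    exact: cvgB (cvgB f2 f1) (cvgMl_tmp (a := h) g1).
  apply/funext => n; rewrite /series /= mulr_sumr -!sumrB.
  by apply: eq_bigr => k _; rewrite /u; ring.
by apply: (limit_norm_le ul) => n; exact: series_half_le uM.
Qed.

Lemma cderivE (f : C -> C) (z l : C) :
  is_derive (z : C^o) 1 (f : C^o -> C^o) l -> cderiv f z = l.
Proof. by move=> fl; rewrite /cderiv derive1E (@derive_val _ _ _ _ _ _ _ fl). Qed.

Lemma near_eq_cderiv (f g : C -> C) (z : C) :
  (\forall w \near (z : C^o), f w = g w) -> cderiv f z = cderiv g z.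
Proof.
by move=> fg; rewrite /cderiv !derive1E; exact: (@near_eq_derive _ C^o C^o f g z 1 fg).
Qed.

(** Two applications of [power_series_at_derive]. The first derivative must exist on a neighbourhood
    for [cderiv f] to agree with the differentiated series there; the second is needed only at the
    centre. *)
Lemma power_series_at_twice_derivable (f : C -> C) (z0 : C) (a : nat -> C) :
  power_series_at f z0 a ->
  (\forall z \near (z0 : C^o), is_derive (z : C^o) 1 (f : C^o -> C^o) (cderiv f z)) /\
  is_derive (z0 : C^o) 1 (cderiv f : C^o -> C^o) (cderiv (cderiv f) z0).
Proof.
move=> /power_series_at_derive[g fg /power_series_at_derive[g' gg' _]].
have fg' : \forall z \near (z0 : C^o), g z = cderiv f z.
  by apply: filterS fg => z /cderivE.
split; first by apply: filterS2 fg fg' => z; move=> /[swap] ->.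
have := @near_eq_is_derive _ C^o C^o g (cderiv f) z0 1 (g' z0) fg' (nbhs_singleton gg').
by move=> d; rewrite (cderivE d).
Qed.

Lemma is_derive_horner_comp (Q : {poly C}) (f : C -> C) (z l : C) :
  is_derive (z : C^o) 1 (f : C^o -> C^o) l ->
  is_derive (z : C^o) 1 ((fun w => Q.[f w]) : C^o -> C^o) (Q^`().[f z] * l).
Proof.
move=> fl; elim/poly_ind: Q => [|Q c IH].
  rewrite deriv0 horner0 mul0r (_ : (fun w => _) = cst 0).
    exact: is_derive_cst.
  by apply/funext => w; rewrite horner0.
rewrite (_ : (fun w => _) =
  ((fun w => Q.[f w]) : C^o -> C^o) * (f : C^o -> C^o) + cst c); last first.
  by apply/funext => w; rewrite /= !fctE !hornerE.
have := is_deriveD (is_deriveM IH fl) (is_derive_cst (c : C^o) (z : C^o) 1).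
move=> /is_derive_eq; apply.
rewrite derivMXaddC !hornerE /= -![_ *: _]/(_ * _); ring.
Qed.

Lemma cderiv2_horner_comp (Q : {poly C}) (f : C -> C) (z : C) (a : nat -> C) :
  power_series_at f z a ->
  cderiv (cderiv (fun w => Q.[f w])) z =
    Q^`()^`().[f z] * cderiv f z ^+ 2 + Q^`().[f z] * cderiv (cderiv f) z.
Proof.
move=> /power_series_at_twice_derivable[fd fdd].
have fz := nbhs_singleton fd.
have e : \forall w \near (z : C^o),
    cderiv (fun u => Q.[f u]) w = Q^`().[f w] * cderiv f w.
  by apply: filterS fd => w /(is_derive_horner_comp Q)/cderivE.
apply: etrans (near_eq_cderiv e) _; apply: cderivE.
have E (p q d1 d2 : C) : p * d2 + d1 * (q * d1) = q * d1 ^+ 2 + p * d2 by ring.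
apply: (is_derive_eq (is_deriveM (is_derive_horner_comp Q^`() fz) fdd)).
exact: E.
Qed.

(** For shift operators this is plain algebra. For differential operators, analyticity of [f] lets
    the chain rule rewrite the value as [L], an expression linear in the polynomial. *)
Lemma apply_op_horner_linear (T : operator R) (f : C -> C) (z : C) (a : nat -> C)
    (c : C) (P Q : {poly C}) :
  power_series_at f z a ->
  apply_op T (fun w => (c *: P + Q).[f w]) z =
    c * apply_op T (fun w => P.[f w]) z + apply_op T (fun w => Q.[f w]) z.
Proof.
move=> fa; case: T => [a2 a1 a0|g V Vs|B D] /=; last 2 first.
- by rewrite !(hornerD, hornerZ); ring.
- by rewrite !(hornerD, hornerZ); ring.
have cd S : cderiv (fun w => S.[f w]) z = S^`().[f z] * cderiv f z.
  apply/cderivE/is_derive_horner_comp.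
  exact: nbhs_singleton (power_series_at_twice_derivable fa).1.
pose L (S : {poly C}) := a2 z * (S^`()^`().[f z] * cderiv f z ^+ 2
  + S^`().[f z] * cderiv (cderiv f) z) + a1 z * (S^`().[f z] * cderiv f z)
  + a0 z * S.[f z].
have LE S : a2 z * cderiv (cderiv (fun w => S.[f w])) z
    + a1 z * cderiv (fun w => S.[f w]) z + a0 z * S.[f z] = L S.
  by congr (_ * _ + _ * _ + _); [exact: cderiv2_horner_comp fa|exact: cd].
apply: etrans (LE _) _.
apply: etrans (esym (congr2 (fun u v => c * u + v) (LE P) (LE Q))).
rewrite /L; move: (cderiv (cderiv f) z) (cderiv f z) => d2 d1.
rewrite !(derivD, derivZ, hornerD, hornerZ); ring.
Qed.

End PowerSeries.

(** * Orthogonality *)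

Section Total.
Variable R : realType.
Implicit Types (S : Defs.support R) (f g : R -> R).

Lemma measurable_interval_points (a b : \bar R) :
  measurable (points (Defs.Interval a b) : set (measurableTypeR R)).
Proof.
apply: is_interval_measurable => x y /= /andP[ax xb] /andP[ay yb] z /andP[xz zy].
by rewrite (lt_le_trans ax) ?lee_fin// (le_lt_trans _ yb) ?lee_fin.
Qed.

Lemma has_total_linear S f g (s t c : R) :
  has_total S f s -> has_total S g t ->
  has_total S (fun x => c * f x + g x) (c * s + t).
Proof.
case: S => [a b|[N|]] /=.
- move=> [fi <-] [gi <-].
  have mD := measurable_interval_points a b.
  have cfi := integrableZl mD c fi; split; last by rewrite RintegralD// RintegralZl.
  by have := integrableD mD cfi gi; apply: eq_integrable => // x _ /=; rewrite EFinD EFinM.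
- by move=> <- <-; rewrite big_split /= mulr_sumr.
- move=> [fn fs] [gn gt]; split.
    apply: (@series_le_cvg _ _ (fun n => `|c| * `|f n%:R| + `|g n%:R|)) => [n|n|n|].
    + exact: normr_ge0.
    + by rewrite addr_ge0 ?mulr_ge0.
    + by rewrite (le_trans (ler_normD _ _))// normrM.
    rewrite (_ : series _ = (fun n => `|c| * series (fun n => `|f n%:R|) n
        + series (fun n => `|g n%:R|) n)).
      by apply: is_cvgD => //; exact: is_cvgMl_tmp.
    by apply/funext => n; rewrite /series /= mulr_sumr -big_split.
  rewrite (_ : series _ = (fun n => c * series (fun n => f n%:R) n
      + series (fun n => g n%:R) n)).
    exact: cvgD (cvgMl_tmp (a := c) fs) gt.
  by apply/funext => n; rewrite /series /= mulr_sumr -big_split.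
Qed.

Lemma has_total_sum S (n : nat) (F : nat -> R -> R) (s c : nat -> R) f0 s0 :
  has_total S f0 s0 -> (forall k, (k < n)%N -> has_total S (F k) (s k)) ->
  has_total S (fun x => \sum_(k < n) c k * F k x) (\sum_(k < n) c k * s k).
Proof.
move=> f0s0; elim: n => [|n IH] Fs.
  (* The empty sum needs the total of the zero function, obtained as - f0 + f0. *)
  have := has_total_linear (-1) f0s0 f0s0; rewrite mulN1r addNr big_ord0.
  under eq_fun do rewrite mulN1r addNr.
  by under [X in _ -> has_total _ X _]eq_fun do rewrite big_ord0.
rewrite big_ord_recr /= addrC.
have -> : (fun x => \sum_(k < n.+1) c k * F k x) =
    (fun x => c n * F n x + \sum_(k < n) c k * F k x).
  by apply/funext => x; rewrite big_ord_recr /= addrC.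
by apply: has_total_linear; [exact: Fs|apply: IH => k kn; exact/Fs/ltnW].
Qed.

Lemma has_total_eq0 S f s :
  has_total S f s -> (forall x, points S x -> f x = 0) -> s = 0.
Proof.
case: S => [a b|[N|]] /=.
- move=> [_ <-] f0; rewrite (@eq_Rintegral _ _ _ _ _ (cst 0)).
    by rewrite Rintegral_cst ?mul0r//; exact: measurable_interval_points.
  by move=> x; rewrite inE => /f0.
- by move=> <- f0; apply: big1 => k _; apply: f0; exists k => //; rewrite -ltnS.
- move=> [_ fs] f0; apply: cvg_unique fs _; first exact: Rhausdorff.
  rewrite (_ : series _ = cst 0); first exact: cvg_cst.
  apply/funext => n; rewrite /series /=; apply: big1 => k _; apply: f0; by exists k.
Qed.

End Total.

Section Orthogonal.
Variables (R : realType) (F : op_family R).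

(** Multiply the vanishing combination by the weight times P_j and total over the support:
    orthogonality leaves c_j h_j = 0 with h_j > 0. *)
Lemma pol_free_on_points (n : nat) (c : nat -> R) :
  (forall k, (k < n)%N -> degree_ok (supp F) k) ->
  (forall x, points (supp F) x ->
    \sum_(k < n) c k * (pol F k).[complex.Re (eta F x%:C)] = 0) ->
  forall j, (j < n)%N -> c j = 0.
Proof.
move=> nok cx0 j jn; have [h h0 orth] := pol_orthogonal F.
pose G k (x : R) := phi0 F x ^+ 2 * (pol F k).[complex.Re (eta F x%:C)]
  * (pol F j).[complex.Re (eta F x%:C)].
have jok := nok _ jn.
have := @has_total_sum _ _ n G (fun k => if k == j then h k else 0) c _ _
  (orth _ _ jok jok) (fun k kn => orth _ _ (nok k kn) jok).
move=> /has_total_eq0 H.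
have /H : forall x, points (supp F) x -> \sum_(k < n) c k * G k x = 0.
  move=> x xS; transitivity (phi0 F x ^+ 2 * (pol F j).[complex.Re (eta F x%:C)]
      * (\sum_(k < n) c k * (pol F k).[complex.Re (eta F x%:C)])).
    by rewrite mulr_sumr; apply: eq_bigr => k _; rewrite /G; ring.
  by rewrite cx0// mulr0.
rewrite (bigD1 (Ordinal jn))//= eqxx big1 ?addr0 => [/eqP|k].
  by rewrite mulf_eq0 (gt_eqF (h0 _ jok)) orbF => /eqP.
by rewrite -val_eqE /= => /negPf ->; rewrite mulr0.
Qed.

End Orthogonal.

(** * The operator on polynomials *)

Section GradedBasis.
Variables (K : idomainType) (P : nat -> {poly K}).

Lemma size_sum_graded_le (c : nat -> K) n :
  (forall k, (k < n)%N -> size (P k) = k.+1) ->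
  (size (\sum_(k < n) c k *: P k)%R <= n)%N.
Proof.
move=> sP; apply: leq_trans (size_sum _ _ _) _; apply/bigmax_leqP => k _.
by apply: leq_trans (size_scale_leq _ _) _; rewrite sP.
Qed.

(** The degree is the largest index with nonzero coefficient, and multiplying coefficients cannot
    raise it. With [e] the eigenvalues, this says that the operator does not raise degrees. *)
Lemma size_sum_graded_mul (c e : nat -> K) n :
  (forall k, (k < n)%N -> size (P k) = k.+1) ->
  (size (\sum_(k < n) (c k * e k) *: P k)%R <= size (\sum_(k < n) c k *: P k)%R)%N.
Proof.
elim: n => [|n IH] sP; first by rewrite !big_ord0.
have sP' k : (k < n)%N -> size (P k) = k.+1 by move=> kn; apply/sP/ltnW.
have [cn0|cn0] := eqVneq (c n) 0.
  by rewrite !big_ord_recr /= cn0 mul0r !scale0r !addr0; exact: IH.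
rewrite [in leqRHS]big_ord_recr /= addrC size_polyDl.
  by rewrite size_scale// sP// (size_sum_graded_le (fun k => c k * e k)).
by rewrite size_scale// sP// ltnS size_sum_graded_le.
Qed.

Lemma graded_free (c : nat -> K) n :
  (forall k, (k < n)%N -> size (P k) = k.+1) ->
  \sum_(k < n) c k *: P k = 0 -> forall k, (k < n)%N -> c k = 0.
Proof.
elim: n => [//|n IH] sP; have sP' k : (k < n)%N -> size (P k) = k.+1.
  by move=> kn; apply/sP/ltnW.
rewrite big_ord_recr /= => c0.
have cn0 : c n = 0.
  apply/eqP; apply: contraTT isT => cn0.
  have : size (\sum_(k < n) c k *: P k + c n *: P n) = 0%N by rewrite c0 size_poly0.
  rewrite addrC size_polyDl; first by rewrite size_scale// sP.
  by rewrite size_scale// sP// ltnS size_sum_graded_le.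
move: c0; rewrite cn0 scale0r addr0 => /(IH sP') ck k.
by rewrite ltnS leq_eqVlt => /predU1P[->|/ck].
Qed.

End GradedBasis.

Lemma graded_span (K : fieldType) (P : nat -> {poly K}) n (p : {poly K}) :
  (forall k, (k < n)%N -> size (P k) = k.+1) -> (size p <= n)%N ->
  exists c : nat -> K, p = \sum_(k < n) c k *: P k.
Proof.
elim: n p => [|n IH] p sP.
  rewrite leqn0 size_poly_eq0 => /eqP ->; exists (fun=> 0); by rewrite big_ord0.
have sP' k : (k < n)%N -> size (P k) = k.+1 by move=> kn; apply/sP/ltnW.
move=> sp; pose a := p`_n / lead_coef (P n).
have lP : lead_coef (P n) != 0 by rewrite lead_coef_eq0 -size_poly_eq0 sP.
have lE : lead_coef (P n) = (P n)`_n by rewrite /lead_coef sP.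
have [|c pc] := IH (p - a *: P n) sP'.
  apply/leq_sizeP => j; rewrite leq_eqVlt => /predU1P[<-|nj]; rewrite coefB coefZ.
    by rewrite -lE divfK// subrr.
  by rewrite !nth_default ?mulr0 ?subr0 ?sP// (leq_trans sp).
exists (fun k => if k == n then a else c k); rewrite big_ord_recr /= eqxx.
rewrite -(subrK (a *: P n) p) pc; congr (_ + _).
by apply: eq_bigr => k _; rewrite ltn_eqF.
Qed.

(** * Existence, uniqueness and linearity of the polynomial representing the operator *)

Section OpPoly.
Variables (R : realType) (F : op_family R) (N : nat).
Hypothesis N_ok : degree_ok (supp F) N.
Local Notation C := R[i].

Lemma degree_ok_le k : (k <= N)%N -> degree_ok (supp F) k.
Proof. by move: N_ok; case: (supp F) => [//|[M|//]] /= + kN; exact: leq_trans. Qed.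

Lemma size_cpol k : (k <= N)%N -> size (cpol F k) = k.+1.
Proof. by move=> kN; rewrite size_map_poly pol_size// degree_ok_le. Qed.

Lemma size_cpol_lt k : (k < N)%N -> size (cpol F k) = k.+1.
Proof. by move=> /ltnW/size_cpol. Qed.

Lemma eta_real_points x : points (supp F) x ->
  eta F x%:C = (complex.Re (eta F x%:C))%:C.
Proof.
move=> /(supp_op_dom (o := F))/(op_dom_sub (o := F))/(eta_real (o := F)) Im0.
by rewrite {1}[eta F _]complexE Im0 mulr0 addr0.
Qed.

(** Expand p - q in the P_k. On the support P_k(eta) is real, so the real and imaginary parts of the
    coefficients give separate vanishing real combinations, to which [pol_free_on_points]
    applies. *)
Lemma eq_poly_on_op_dom (p q : {poly C}) : (size p <= N)%N -> (size q <= N)%N ->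
  (forall z, op_dom F z -> p.[eta F z] = q.[eta F z]) -> p = q.
Proof.
move=> sp sq pq; apply/eqP; rewrite -subr_eq0; apply/eqP.
have spq : (size (p - q)%R <= N)%N.
  by rewrite (leq_trans (size_polyD _ _))// size_polyN geq_max sp.
have [c pqc] := graded_span size_cpol_lt spq; rewrite pqc.
apply: big1 => j _.
have ok k : (k < N)%N -> degree_ok (supp F) k by move=> /ltnW; exact: degree_ok_le.
have c0 x : points (supp F) x ->
    \sum_(k < N) c k * ((pol F k).[complex.Re (eta F x%:C)])%:C = 0.
  move=> xS; have /pq pq0 := supp_op_dom xS.
  transitivity ((p - q).[eta F x%:C]); last by rewrite hornerD hornerN pq0 subrr.
  rewrite pqc horner_sum; apply: eq_bigr => k _.
  by rewrite hornerZ eta_real_points// horner_map.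
have cRe : complex.Re (c j) = 0.
  apply: (pol_free_on_points (c := fun k => complex.Re (c k)) ok) (ltn_ord j).
  move=> x /c0/(congr1 (@complex.Re R)).
  rewrite (raddf_sum (@complex.Re R : Rcomplex R -> R)) /= => {2}<-.
  by apply: eq_bigr => k _; case: (c k) => a b /=; rewrite mulr0 subr0.
have cIm : complex.Im (c j) = 0.
  apply: (pol_free_on_points (c := fun k => complex.Im (c k)) ok) (ltn_ord j).
  move=> x /c0/(congr1 (@complex.Im R)).
  rewrite (raddf_sum (@complex.Im R : Rcomplex R -> R)) /= => {2}<-.
  by apply: eq_bigr => k _; case: (c k) => a b /=; rewrite mulr0 add0r.
by rewrite [c j]complexE cRe cIm mulr0 addr0 scale0r.
Qed.

Lemma eta_power_series z : op_dom F z -> exists a, power_series_at (eta F) z a.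
Proof. by move=> /(op_dom_sub (o := F)); exact: eta_analytic. Qed.

Lemma apply_op_sum (I : Type) (r : seq I) (c : I -> C) (Q : I -> {poly C}) z :
  op_dom F z ->
  apply_op (op F) (fun w => (\sum_(i <- r) c i *: Q i).[eta F w]) z =
  \sum_(i <- r) c i * apply_op (op F) (fun w => (Q i).[eta F w]) z.
Proof.
move=> /eta_power_series[a etaa]; elim: r => [|i r IH].
  (* Linearity applied to 0 = - 0 + 0 shows that the operator sends 0 to 0. *)
  rewrite !big_nil (_ : 0 = -1 *: 0 + 0 :> {poly C}) ?scaler0 ?addr0//.
  have := apply_op_horner_linear (op F) (-1) 0 0 etaa.
  by rewrite scaler0 addr0 mulN1r addNr.
by rewrite !big_cons (apply_op_horner_linear _ _ _ _ etaa) IH.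
Qed.

Lemma op_poly_spec (Q : {poly C}) : (size Q <= N)%N -> is_op_poly F Q (op_poly F Q).
Proof.
move=> sQ; apply: (@xgetPex _ 0 [set r | is_op_poly F Q r]%classic).
have [c Qc] := graded_span size_cpol_lt sQ.
(* The witness multiplies each coordinate of Q by its eigenvalue; its existence ensures that [xget]
   does not fall back on the default 0. *)
exists (\sum_(k < N) (c k * (energy F k)%:C) *: cpol F k); split.
  by rewrite Qc; exact: (size_sum_graded_mul c (fun k => (energy F k)%:C) size_cpol_lt).
move=> z zA; rewrite Qc apply_op_sum// horner_sum; apply: eq_bigr => k _.
rewrite pol_eigen//; last exact/degree_ok_le/ltnW.
by rewrite hornerZ mulrA.
Qed.

Lemma op_polyE (Q r : {poly C}) : (size Q <= N)%N -> (size r <= N)%N ->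
  (forall z, op_dom F z -> apply_op (op F) (fun w => Q.[eta F w]) z = r.[eta F z]) ->
  op_poly F Q = r.
Proof.
move=> sQ sr Qr; have [sop opE] := op_poly_spec sQ.
apply: eq_poly_on_op_dom => //; first exact: leq_trans sop sQ.
by move=> z zA; rewrite -opE// Qr.
Qed.

Lemma op_poly_sum (I : Type) (r : seq I) (c : I -> C) (Q : I -> {poly C}) :
  (forall i, (size (Q i) <= N)%N) ->
  op_poly F (\sum_(i <- r) c i *: Q i) = \sum_(i <- r) c i *: op_poly F (Q i).
Proof.
have ssum (S : I -> {poly C}) : (forall i, (size (S i) <= N)%N) ->
    (size (\sum_(i <- r) c i *: S i)%R <= N)%N.
  move=> sS; elim/big_ind: _ => [|p q sp sq|i _]; first by rewrite size_poly0.
    by rewrite (leq_trans (size_polyD _ _))// geq_max sp.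
  exact: leq_trans (size_scale_leq _ _) (sS i).
move=> sQ; apply: op_polyE; first exact: ssum.
  apply: (ssum (fun i => op_poly F (Q i))) => i.
  exact: leq_trans (op_poly_spec (sQ i)).1 (sQ i).
move=> z zA; rewrite apply_op_sum// horner_sum; apply: eq_bigr => i _.
by rewrite hornerZ (op_poly_spec (sQ i)).2.
Qed.

Lemma op_poly_cpol k : (k < N)%N -> op_poly F (cpol F k) = (energy F k)%:C *: cpol F k.
Proof.
move=> kN; have sk : (size (cpol F k) <= N)%N by rewrite size_cpol_lt.
apply: op_polyE => //; first exact: leq_trans (size_scale_leq _ _) sk.
by move=> z zA; rewrite pol_eigen// ?hornerZ//; exact/degree_ok_le/ltnW.
Qed.

(** In coordinates the equation reads c_k (E(k) - E(m)) = 0, and distinct eigenvalues kill every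
    coordinate except the m-th. *)
Lemma op_poly_eigen m (Q : {poly C}) : (m < N)%N -> (size Q <= N)%N ->
  op_poly F Q = (energy F m)%:C *: Q -> exists c, Q = c *: cpol F m.
Proof.
move=> mN sQ opQ; have [c Qc] := graded_span size_cpol_lt sQ.
have ck0 : forall k, (k < N)%N -> c k * ((energy F k)%:C - (energy F m)%:C) = 0.
  apply: (graded_free size_cpol_lt); move: opQ.
  rewrite Qc op_poly_sum => [/eqP|k]; last by rewrite size_cpol_lt.
  rewrite -subr_eq0 scaler_sumr -sumrB => /eqP opQ; rewrite -[RHS]opQ; apply: eq_bigr => k _.
  by rewrite op_poly_cpol// !scalerA -scalerBl mulrBr [(energy F m)%:C * _]mulrC.
exists (c m); rewrite Qc (bigD1 (Ordinal mN))//= big1 ?addr0// => k km.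
have /eqP := ck0 k (ltn_ord k); rewrite mulf_eq0 => /orP[/eqP ->|]; first by rewrite scale0r.
rewrite subr_eq0 => /eqP/complexI/(energy_inj (o := F)) E.
by case/eqP: km; apply: val_inj; apply: E; exact/degree_ok_le/ltnW.
Qed.

End OpPoly.

(** * The eigenvector equation read at the nodes *)

Theorem theorem3p2 (R : realType) (F : op_family R) (N : nat)
    (N_gt0 : (0 < N)%N) (N_below_top : degree_below_top (supp F) N)
    (x : 'I_N -> R)
    (x_dom : forall n, eta_dom F (x n)%:C)
    (x_inj : injective (fun n => eta F (x n)%:C))
    (x_zeros : forall y : R[i],
       root (cpol F N) y <-> exists n, y = eta F (x n)%:C)
    (x_etadot : forall n, etadot F (x n) != 0)
    (m : nat) (m_lt_N : (m < N)%N)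
    (v : 'cV[R[i]]_N) (v_neq0 : v != 0)
    (v_eigen : M_matrix F x *m v = (energy F N - energy F m)%:C *: v) :
  exists2 kappa : R[i], kappa != 0 &
    \sum_(n < N) (etadot F (x n) * v n 0) *: node_poly F x n
    = kappa *: cpol F m.
Proof.
have N_ok : degree_ok (supp F) N.
  by move: N_below_top; case: (supp F) => [//|[M|//]] /=; exact: ltnW.
set Q := \sum_(n < N) _; set y := fun n => eta F (x n)%:C.
have snode n : (size (node_poly F x n) <= N)%N.
  (* Restoring the missing factor gives the product over all N nodes, of size N + 1. *)
  have nM : node_poly F x n * ('X - (y n)%:P) = \prod_(j <- enum 'I_N) ('X - (y j)%:P).
    by rewrite big_enum /= [RHS](bigD1 n)//= mulrC.
  have : size (node_poly F x n * ('X - (y n)%:P)) = N.+1.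
    by rewrite nM size_prod_XsubC size_enum_ord.
  have [->|nz] := eqVneq (node_poly F x n) 0; first by rewrite size_poly0.
  by rewrite size_mul ?polyXsubC_eq0// size_XsubC addn2 /= => -[->].
have sQ : (size Q <= N)%N.
  rewrite (leq_trans (size_sum _ _ _))//; apply/bigmax_leqP => n _.
  exact: leq_trans (size_scale_leq _ _) (snode n).
have nodeE n : (node_poly F x n).[y n] = \prod_(j < N | j != n) (y n - y j).
  by rewrite /node_poly horner_prod; apply: eq_bigr => j _; rewrite hornerXsubC.
have node_neq0 n : (node_poly F x n).[y n] != 0.
  rewrite nodeE prodf_seq_neq0; apply/allP => j _; apply/implyP => jn.
  by rewrite subr_eq0; apply: contra jn => /eqP/x_inj ->.
have node0 n k : k != n -> (node_poly F x k).[y n] = 0.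
  move=> kn; rewrite /node_poly horner_prod (bigD1 n) 1?eq_sym//=.
  by rewrite hornerXsubC subrr mul0r.
have Qy n : Q.[y n] = etadot F (x n) * v n 0 * (node_poly F x n).[y n].
  rewrite horner_sum (bigD1 n)//= hornerZ big1 ?addr0// => k kn.
  by rewrite hornerZ node0// mulr0.
have opQE : op_poly F Q =
    \sum_(n < N) (etadot F (x n) * v n 0) *: op_poly F (node_poly F x n).
  exact: (op_poly_sum N_ok).
have clear_denom (a b c d e w : R[i]) : d != 0 ->
    - (a * (b - e * c) / d) * w * - d = a * w * b - e * (a * w * c).
  by move=> d0; field.
have opQ : op_poly F Q = (energy F m)%:C *: Q.
  apply/eqP; rewrite -subr_eq0; apply/eqP.
  (* The difference has size at most N, so N distinct roots force it to be 0. *)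
  apply: (@roots_geq_poly_eq0 _ _ (map y (enum 'I_N))).
  - apply/allP => _ /mapP[n _ ->]; rewrite /root hornerD hornerN hornerZ subr_eq0; apply/eqP.
    move: v_eigen => /matrixP/(_ n 0); rewrite !mxE.
    have d0 : etadot F (x n) * (node_poly F x n).[y n] != 0 by rewrite mulf_neq0.
    (* Multiplying row n by minus the denominator of [M_matrix] turns its left side into ((H - E(N))
       Q)(y_n) and its right side into (E(m) - E(N)) Q(y_n). *)
    move=> /(congr1 (fun t => t * - (etadot F (x n) * (node_poly F x n).[y n]))).
    rewrite mulr_suml (_ : \sum_(k < N) _ = (op_poly F Q).[y n] - (energy F N)%:C * Q.[y n]).
      move=> /eqP; rewrite subr_eq => /eqP ->.
      by rewrite rmorphB /= Qy; ring.
    rewrite opQE !horner_sum mulr_sumr -sumrB; apply: eq_bigr => k _.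
    rewrite mxE -nodeE !(hornerD, hornerN, hornerZ); exact: clear_denom d0.
  - by rewrite map_inj_uniq ?enum_uniq.
  - rewrite size_map size_enum_ord (leq_trans (size_polyD _ _))// geq_max size_polyN.
    rewrite (leq_trans (op_poly_spec N_ok sQ).1 sQ).
    exact: leq_trans (size_scale_leq _ _) sQ.
have [kappa Qk] := op_poly_eigen N_ok m_lt_N sQ opQ.
(* If kappa were 0, Q would vanish at each node, where its value is v_n times nonzero factors. *)
exists kappa => //; apply: contra v_neq0 => /eqP k0.
apply/eqP/matrixP => n j; rewrite ord1 mxE.
move: (Qy n); rewrite Qk k0 scale0r horner0 => /esym/eqP.
by rewrite !mulf_eq0 (negPf (x_etadot n)) (negPf (node_neq0 n)) orbF => /eqP.
Qed.
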